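(* Let $(C_k)_{k\ge0}$, $(\Omega_k)_{k\ge0}$ be a nested tangent configuration with transition operators $G_k:\partial C_k\to\partial C_{k+1}$ (as defined in the context), let $p$ be a tangency point (with $p\in T_k$ for all $k$), and assume that the uniform bounds (B) of the context hold at $p$ for all $k$. Let $c_{k+1}=G_k(c_k)$ be an orbit and let $s_k$ denote the geodesic coordinate of $c_k$ on $\partial C_k$ centered at $p$. Assume that the orbit lies in a tangency neighborhood of $p$, i.e. $|s_0|<r$, where $A>0$ and $r>0$ are constants such that every orbit with initial coordinate of absolute value less than $r$ has all its coordinates of absolute value less than $r$, converges to $p$, and satisfies $|s_{k+1}|\le A|s_k|^2$ for all $k$. Then there exist constants $C>0$ and $0<\rho<1$ such that $$|s_k|\le C\rho^{2^k}\qquad\text{for all }k\ge0.$$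
   Context: Everything takes place in $\mathbb{R}^2$. For a compact convex set $C$ with smooth boundary, $\nu_C(c)$ is the outward unit normal at $c\in\partial C$; $n_\Omega(x)$ is the inward unit normal to $\partial\Omega$ at $x$. Geometric normal property: an open set $\Omega\supset C$ satisfies the $C$-geometric normal property if (1) $C\subset\Omega$; (2) $\partial\Omega$ is $C^1$ outside $C$; (3) for any $c\in\partial C$ there is an outward normal ray $\Delta_c$ such that $\Delta_c\cap\Omega$ is connected; (4) for almost every $x\in\partial\Omega$, the inward normal ray starting at $x$ intersects $C$. Nested tangent configuration: sequences $C_0\supset C_1\supset C_2\supset\dots$ and $\Omega_0\subset\Omega_1\subset\Omega_2\subset\dots$ such that: each $C_k$ is a compact convex set with $C^3$ boundary and strictly positive curvature $\kappa_k>0$; each $\Omega_k$ is an open set containing $C_k$ with smooth boundary; each $\Omega_k$ satisfies the $C_k$-geometric normal property; all $\Omega_k$ are contained in a limiting domain $\Omega_\infty$; and for each $k$, $\partial C_{k+1}$ is tangent to $\partial C_k$ at least at one point. Tangency set: $T_k=\{c\in\partial C_k\cap\partial C_{k+1}:\nu_{C_k}(c)=\nu_{C_{k+1}}(c)\}$. Thickness function: $d_k(c)=\sup\{r\ge0: c+r\nu_{C_k}(c)\in\Omega_k\}$ for $c\in\partial C_k$. Radial map: $\Phi_{\Omega_k,C_k}:\partial C_k\to\partial\Omega_k$, $\Phi_{\Omega_k,C_k}(c)=c+d_k(c)\nu_{C_k}(c)$. Reciprocal map: $\pi_{\Omega_k,C_{k+1}}$ sends $x\in\partial\Omega_k$ to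 the first intersection of the inward normal ray $\{x+t\,n_{\Omega_k}(x):t\ge0\}$ with $\partial C_{k+1}$. Transition operator: $G_k=\pi_{\Omega_k,C_{k+1}}\circ\Phi_{\Omega_k,C_k}:\partial C_k\to\partial C_{k+1}$. Geodesic coordinate centered at $p$: signed arc length along the boundary curve measured from $p$. $R_k(p)$ is the radius of curvature of $\partial\Omega_k$ at $\Phi_{\Omega_k,C_k}(p)$. Uniform bounds (B): there are constants with $0<\kappa_{\min}\le\kappa_k(p),\kappa_{k+1}(p)\le\kappa_{\max}$; there is $\delta>0$ with $\kappa_{k+1}(p)-\kappa_k(p)\ge\delta$; $0<d_{\min}\le d_k(p)\le d_{\max}$; $0<R_{\min}\le R_k(p)\le R_{\max}$. *)

(* Defs.v *)
From HB Require Import structures.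
From mathcomp Require Import all_boot all_order all_algebra.
From mathcomp Require Import all_classical all_reals all_analysis.

Set Implicit Arguments.
Unset Strict Implicit.
Unset Printing Implicit Defensive.

Import Order.TTheory GRing.Theory Num.Theory.
Import numFieldNormedType.Exports.

Local Open Scope ring_scope.
Local Open Scope classical_set_scope.

(* The Euclidean plane is [R * R].  The library's norm on this product is the
   max norm: it is only used for its topology, and for coverings by squares in
   [H1_null].  Lengths and angles are measured with [dotp]. *)

Section Plane.
Variable R : realType.
Implicit Types (u v x y n c p : R * R) (S C Omega : set (R * R)).

Definition dotp u v : R := u.1 * v.1 + u.2 * v.2.

(* counterclockwise rotation by a right angle *)
Definition rot90 u : R * R := (- u.2, u.1).

Definition boundary S : set (R * R) := closure S `\` interior S.

Definition ray x u : set (R * R) := [set x + t *: u | t in [set t : R | 0 <= t]].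

Definition Cdiff (m : nat) (f : R -> R) : Prop :=
  (forall j, (j < m)%N -> forall t, derivable f^`(j) t 1) /\
  continuous f^`(m).

Definition smooth (f : R -> R) : Prop := forall m, Cdiff m f.

(* Near x, S is the region above the graph of f, in the orthonormal frame with
   origin x and vertical axis n; the graph is tangent to the horizontal axis
   at x, so n is the inward unit normal at x.  Points on the graph itself are
   left unconstrained, so that the definition applies to open and to closed
   sets. *)
Definition boundary_graph S x n (f : R -> R) : Prop :=
  [/\ dotp n n = 1, f 0 = 0, f^`() 0 = 0 &
      \forall y \near x,
        let t := dotp (y - x) (rot90 n) in
        let h := dotp (y - x) n in
        (f t < h -> S y) /\ (h < f t -> ~ S y)].

(* Regularity of the boundary at x.  Only the germ of f at 0 matters, so it is
   harmless to ask for regularity of f on the whole line. *)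
Definition regular_boundary_at (regular : (R -> R) -> Prop) S x : Prop :=
  exists n f, regular f /\ boundary_graph S x n f.

Definition regular_boundary (regular : (R -> R) -> Prop) S : Prop :=
  forall x, boundary S x -> regular_boundary_at regular S x.

(* [get] returns a junk value where the boundary is not C^1; elsewhere the
   normal is uniquely determined.  The same holds for [curvature], with C^2. *)
Definition inward_normal S x : R * R :=
  get [set n | exists f, Cdiff 1 f /\ boundary_graph S x n f].

Definition outward_normal S x : R * R := - inward_normal S x.

(* The curvature of the graph of f at a point where f' = 0 is f''; it is
   nonnegative where S is convex. *)
Definition curvature S x : R :=
  get [set f^`(2) 0 | f in
       [set f | Cdiff 2 f /\ boundary_graph S x (inward_normal S x) f]].

(* unsigned; a flat point gets radius 0 instead of +oo *)
Definition curvature_radius S x : R := `|curvature S x|^-1.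

(* N has vanishing one-dimensional Hausdorff measure: it has countable
   coverings with arbitrarily small sum of diameters. *)
Definition H1_null (N : set (R * R)) : Prop :=
  forall e : R, 0 < e ->
    exists (a : nat -> R * R) (rad : nat -> R),
      [/\ forall i, 0 <= rad i,
          N `<=` \bigcup_i ball (a i) (rad i) &
          (\sum_(i <oo) (rad i)%:E <= e%:E)%E].

(* The outward normal ray at c is unique since C has smooth boundary. *)
Definition geometric_normal_property C Omega : Prop :=
  [/\ open Omega,
      C `<=` Omega,
      forall x, boundary Omega x -> ~ C x ->
        regular_boundary_at (Cdiff 1) Omega x,
      forall c, boundary C c ->
        connected (ray c (outward_normal C c) `&` Omega) &
      H1_null [set x | boundary Omega x /\
                       ~ (ray x (inward_normal Omega x) `&` C !=set0)]].

Definition tangency_set C C' : set (R * R) :=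
  [set c | [/\ boundary C c, boundary C' c &
               outward_normal C c = outward_normal C' c]].

Record nested_tangent_configuration
    (C Omega : nat -> set (R * R)) (Omega_oo : set (R * R)) : Prop := {
  ntc_C_decr : forall k, C k.+1 `<=` C k ;
  ntc_Omega_incr : forall k, Omega k `<=` Omega k.+1 ;
  ntc_C_compact : forall k, compact (C k) ;
  ntc_C_convex : forall k, convex_set (C k) ;
  ntc_C_C3 : forall k, regular_boundary (Cdiff 3) (C k) ;
  ntc_C_curvature : forall k c, boundary (C k) c -> 0 < curvature (C k) c ;
  ntc_Omega_open : forall k, open (Omega k) ;
  ntc_C_Omega : forall k, C k `<=` Omega k ;
  ntc_Omega_smooth : forall k, regular_boundary smooth (Omega k) ;
  ntc_normal : forall k, geometric_normal_property (C k) (Omega k) ;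
  ntc_limit_open : open Omega_oo ;
  ntc_limit_connected : connected Omega_oo ;
  ntc_Omega_limit : forall k, Omega k `<=` Omega_oo ;
  ntc_tangent : forall k, tangency_set (C k) (C k.+1) !=set0 }.

(* +oo if the outward normal ray never leaves Omega for good *)
Definition thickness Omega C c : \bar R :=
  ereal_sup [set r%:E | r in
             [set r : R | 0 <= r /\ Omega (c + r *: outward_normal C c)]].

(* [radial_map Omega C c x] : Phi_{Omega,C} is defined at c and takes the
   value x there. *)
Definition radial_map Omega C c x : Prop :=
  exists d : R, [/\ boundary C c, thickness Omega C c = d%:E,
    x = c + d *: outward_normal C c & boundary Omega x].

(* [reciprocal_map Omega C' x c'] : the inward normal ray of Omega at x meets
   the boundary of C', for the first time at c'. *)
Definition reciprocal_map Omega C' x c' : Prop :=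
  exists t : R, [/\ boundary Omega x, 0 <= t,
    c' = x + t *: inward_normal Omega x, boundary C' c' &
    forall t', 0 <= t' < t -> ~ boundary C' (x + t' *: inward_normal Omega x)].

(* The graph of G = pi_{Omega,C'} \o Phi_{Omega,C}, a functional relation
   which is not required to be total. *)
Definition transition Omega C C' c c' : Prop :=
  exists x, radial_map Omega C c x /\ reciprocal_map Omega C' x c'.

Definition transition_orbit (C Omega : nat -> set (R * R)) (c : nat -> R * R) : Prop :=
  forall k, transition (Omega k) (C k) (C k.+1) (c k) (c k.+1).

(* gamma is a simple closed unit-speed parametrization of the boundary of C, of
   length L, travelled counterclockwise. *)
Definition arclength_param C (L : R) (gamma : R -> R * R) : Prop :=
  [/\ 0 < L,
      forall s : R, is_derive s 1 gamma (rot90 (outward_normal C (gamma s))),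
      range gamma = boundary C &
      forall s t : R, gamma s = gamma t <-> exists m : int, t = s + m%:~R * L].

(* s is the signed arc length from p to c along the shorter of the two arcs *)
Definition geodesic_coordinate C p c (s : R) : Prop :=
  exists (L : R) (gamma : R -> R * R),
    [/\ arclength_param C L gamma, gamma 0 = p, gamma s = c &
        - (L / 2) < s <= L / 2].

(* All constants are uniform in k, except for the curvature gap delta: a
   uniform gap would make the curvatures at p unbounded, against kappa_max.
   This is implied by the version with uniform delta. *)
Definition uniform_bounds (C Omega : nat -> set (R * R)) p : Prop :=
  exists kappa_min kappa_max d_min d_max R_min R_max : R,
  exists delta : nat -> R,
    [/\ 0 < kappa_min, 0 < d_min & 0 < R_min] /\
    forall k,
    [/\ kappa_min <= curvature (C k) p <= kappa_max /\
        kappa_min <= curvature (C k.+1) p <= kappa_max,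
        0 < delta k /\
        delta k <= curvature (C k.+1) p - curvature (C k) p,
        (d_min%:E <= thickness (Omega k) (C k) p <= d_max%:E)%E &
        exists2 x, radial_map (Omega k) (C k) p x &
                   R_min <= curvature_radius (Omega k) x <= R_max].

End Plane.

(* Main.v *)
Require Import Defs.
From mathcomp Require Import all_boot all_order all_algebra.
From mathcomp Require Import all_classical all_reals all_analysis.
From mathcomp Require Import ring lra.
Import Order.TTheory GRing.Theory Num.Theory.
Import numFieldNormedType.Exports.
Local Open Scope ring_scope.
Local Open Scope classical_set_scope.

(** A sequence with |s_{k+1}| <= A |s_k|^2 decays doubly exponentially as soon
    as A |s_K| < 1 for one index K, since A |s_k| is then squared at each later
    step ([quadratic_recursion_doubly_exponential]).  The radius r is not
    assumed to be small compared with 1/A, so such a K has to come from the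
    convergence of the orbit to p.  That convergence is only one of points of
    the plane: the content of the proof is that closeness to p in the plane
    forces closeness to p along the boundary of C_k, uniformly in k, although
    the bodies C_k vary and could become arbitrarily thin.

    What is uniform in k is a disc.  As C_0 is compact, convex, and positively
    curved at p, it lies in a disc tangent to its boundary at p
    ([compact_convex_disc]): with n the inward normal at p and a the diameter,
    |y - p|^2 <= a <y - p, n> for all y in C_0.  Every C_k is contained in C_0
    and shares the normal n, so it satisfies the same inequality.

    Let h and x be the coordinates of an arc length parametrization of the
    boundary of C_k, along n and along the tangent at p.  A convex body lies on
    one side of each tangent line, so a critical point of x or of h is a global
    extremum of that function.  Hence h increases from p up to its maximum and
    then decreases back to p.  Take a point c with height h(c) small, before the
    maximum say: the whole arc from p to c is below height h(c), so by the disc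
    inequality x is small on it too.  Along this arc h increases while x
    increases, then decreases, so that its length is at most the sum of the
    variations of h and x, which is small ([loop_arc_le]).  After the maximum,
    the same holds for the other arc from c to p, by a reflection
    ([convex_loop_reflect]).  The geodesic coordinate of c is the length of the
    shorter arc, up to sign, so it tends to 0 with h(c)
    ([geodesic_coordinate_le]). *)

(** * Monotonicity of functions of one real variable *)

Lemma derive_approx {R : realType} {f : R -> R} {x a e : R} :
  is_derive x 1 f a -> 0 < e ->
  \forall u \near (0 : R), `|f (x + u) - f x - a * u| <= e * `|u|.
Proof.
move=> dfx e0.
have : h^-1 *: (f (h *: 1 + x) - f x) @[h --> (0:R)^'] --> a.
  by rewrite -(@derive_val _ _ _ _ _ _ _ dfx); exact: (@ex_derive _ _ _ _ _ _ _ dfx).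
move=> /cvgrPdist_le /(_ _ e0); rewrite near_withinE; apply: filterS => u /=.
have [->|u0] := eqVneq u 0; first by rewrite addr0 mulr0 !subrr normr0 mulr0.
move=> /(_ isT); rewrite scaler1 -[_ *: _]/(_ * _) => H.
have -> : f (x + u) - f x - a * u = - (a - u^-1 * (f (u + x) - f x)) * u.
  by rewrite (addrC u x); field.
by rewrite normrM normrN ler_wpM2r.
Qed.

(** A point t with F t < 0 would force f to have, on [t, b], a minimum lower
    than f t, hence interior; there F vanishes although f is below f b. *)
Lemma derive_ge0_unimodal {R : realType} {f F : R -> R} {a b : R} :
  (forall t : R, is_derive t 1 f (F t)) ->
  (forall t, a <= t <= b -> f t <= f b) ->
  (forall t, a < t < b -> F t = 0 -> f b <= f t) ->
  forall t, a < t < b -> 0 <= F t.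
Proof.
move=> df maxb crit t /andP[at_ tb]; rewrite leNgt; apply/negP => Ft0.
have fc u v : {within `[u, v], continuous f}.
  by apply: derivable_within_continuous => y _; exact: ex_derive.
have [u /andP[tu ub] fu] : exists2 u, t < u < b & f u < f t.
  have Ft2 : 0 < - F t / 2 by rewrite divr_gt0 // oppr_gt0.
  have [d /= d0 dP] := (nbhs_ballP _ _).1 (derive_approx (df t) Ft2).
  pose v := Num.min d (b - t) / 2.
  have v0 : 0 < v by rewrite divr_gt0 // lt_min d0 subr_gt0.
  have [vd vb] : v < d /\ v < b - t.
    have : v < Num.min d (b - t) by rewrite ltr_pdivrMr //; move: v0; rewrite /v; lra.
    by rewrite lt_min => /andP.
  exists (t + v); first by lra.
  have : ball 0 d v by rewrite -ball_normE /ball_ /= sub0r normrN gtr0_norm.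
  move=> /dP /=; rewrite (gtr0_norm v0) ler_norml => /andP[_]; nra.
(* [u] shows that the minimum over [t, b] is not reached at t, and f b is no
   smaller than f t: the minimum is interior. *)
have [w] := EVT_min (ltW tb) (fc t b); rewrite in_itv /= => /andP[tw wb] minw.
have fw : f w < f t by apply: le_lt_trans fu; apply: minw; rewrite in_itv /= !ltW.
have ftb : f t <= f b by apply: maxb; rewrite !ltW.
have wt : t < w by rewrite lt_neqAle tw andbT; apply/eqP => E; rewrite E ltxx in fw.
have wb' : w < b.
  by rewrite lt_neqAle wb andbT; apply/eqP => E; move: (lt_le_trans fw ftb); rewrite E ltxx.
have dw : is_derive w 1 f 0.
  apply: (derive1_at_min (ltW tb)) => [y _||y]; first exact: ex_derive.
    by rewrite in_itv /= wt.
  by rewrite in_itv /= => /andP[/ltW ty /ltW yb]; apply: minw; rewrite in_itv /= ty.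
have Fw : F w = 0.
  by rewrite -(@derive_val _ _ _ _ _ _ _ (df w)) (@derive_val _ _ _ _ _ _ _ dw).
have /crit/(_ Fw) : a < w < b by rewrite wb' (lt_trans at_ wt).
by rewrite leNgt (lt_le_trans fw ftb).
Qed.

Lemma increment_ge_length {R : realType} {f F : R -> R} {a b : R} :
  (forall t : R, is_derive t 1 f (F t)) ->
  (forall t, a < t < b -> 1 <= F t) -> a <= b -> b - a <= f b - f a.
Proof.
move=> df F1; rewrite le_eqVlt => /predU1P[->|ab]; first by rewrite !subrr.
have [|t] := @MVT R f F a b ab (fun t _ => df t).
  by apply: derivable_within_continuous => y _; exact: ex_derive.
by rewrite in_itv /= => tab ->; rewrite ler_peMl ?F1 // subr_ge0 ltW.
Qed.

(** * Lengths of arcs of convex curves *)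

(** The boundary of a convex body of length L, parametrized counterclockwise by
    arc length from a point with horizontal tangent, in coordinates (x, h) such
    that the body is in the half-plane h >= 0.  [loop_support] says that the
    curve stays on the left of each tangent line, and [loop_disc] that it is
    contained in the disc of diameter a tangent to the axis at the start. *)
Record convex_loop {R : realType} (x h X H : R -> R) (L a : R) : Prop := {
  loop_dx : forall s : R, is_derive s 1 x (X s);
  loop_dh : forall s : R, is_derive s 1 h (H s);
  loop_unit : forall s, X s ^+ 2 + H s ^+ 2 = 1;
  loop_support : forall s t, 0 <= X s * (h t - h s) - H s * (x t - x s);
  loop_start : x 0 = 0 /\ h 0 = 0;
  loop_end : x L = 0 /\ h L = 0;
  loop_disc : forall s, x s ^+ 2 + h s ^+ 2 <= a * h s;
  loop_pos : forall s, 0 < s < L -> 0 < h s }.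

(** The reflection in the h axis reverses the orientation, so the curve must be
    travelled backwards to be counterclockwise again.  This exchanges the two
    arcs that join a point of the curve to the start. *)
Lemma convex_loop_reflect {R : realType} {x h X H : R -> R} {L a : R} :
  convex_loop x h X H L a ->
  convex_loop (fun t => - x (L - t)) (fun t => h (L - t))
              (fun t => X (L - t)) (fun t => - H (L - t)) L a.
Proof.
case=> dx dh un su [x0 h0] [xL hL] di po.
have dL (f F : R -> R) (s : R) : (forall t : R, is_derive t 1 f (F t)) ->
    is_derive s 1 (fun t => f (L - t)) (- F (L - s)).
  move=> df; have dl : is_derive s 1 (fun t => L - t) (- 1 : R).
    have := is_deriveB (is_derive_cst L s (1 : R)) (is_derive_id s (1 : R)).
    by rewrite sub0r.
  by have := @is_derive1_comp R f (fun t => L - t) s _ _ (df (L - s)) dl; rewrite mulrN1.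
split; rewrite ?subr0 ?subrr ?x0 ?h0 ?xL ?hL ?oppr0 //.
- move=> s; have := is_deriveN (dL _ _ s dx).
  by rewrite opprK.
- by move=> s; exact: dL.
- by move=> s; rewrite sqrrN.
- by move=> s t; have := su (L - s) (L - t); lra.
- by move=> s; rewrite sqrrN.
- by move=> s sL; apply: po; lra.
Qed.

(** At a critical point of h the tangent is horizontal.  If it points in the
    direction of increasing x, the curve is above this tangent, but the start
    of the curve is below; so it points the other way, and the curve is below:
    the point is a maximum. *)
Lemma loop_h_incr {R : realType} {x h X H : R -> R} {L a m : R} :
  convex_loop x h X H L a -> m <= L -> (forall t, 0 <= t <= L -> h t <= h m) ->
  forall t, 0 < t < m -> 0 <= H t.
Proof.
case=> dx dh un su [x0 h0] [xL hL] di po mL hm.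
apply: (derive_ge0_unimodal dh).
  by move=> t /andP[t0 tm]; apply: hm; rewrite t0 (le_trans tm mL).
move=> t /andP[t0 tm] Ht.
have ht : 0 < h t by apply: po; rewrite t0 (lt_le_trans tm mL).
have := un t; rewrite Ht expr0n addr0 => /eqP; rewrite sqrf_eq1 => /orP[]/eqP Xt.
  by have := su t 0; rewrite Ht Xt h0; lra.
by have := su t m; rewrite Ht Xt; lra.
Qed.

(** Up to s, which comes before the maximum m of h, the heights are at most
    h s, and [loop_disc] bounds |x| by e.  There H >= 0, so a critical point of
    x has an upward tangent with the curve on its left, and is a maximum of x:
    x increases up to some n and then decreases.  As |X| + H >= 1, the functions
    x + h and h - x increase at least at unit speed before and after n. *)
Lemma loop_arc_le {R : realType} {x h X H : R -> R} {L a m s e : R} :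
  convex_loop x h X H L a -> m <= L -> (forall t, 0 <= t <= L -> h t <= h m) ->
  0 <= s <= m -> 0 <= e -> a * h s <= e ^+ 2 -> 0 <= a -> h s <= e -> s <= 4 * e.
Proof.
move=> lo mL hm /andP[s0 sm] e0 ahe a0 he.
have Hge0 := loop_h_incr lo mL hm.
case: lo => dx dh un su [x0 h0] [xL hL] di po.
have fc (f F : R -> R) : (forall t : R, is_derive t 1 f (F t)) ->
    forall u v, {within `[u, v], continuous f}.
  by move=> df u v; apply: derivable_within_continuous => y _; exact: ex_derive.
have hle t : 0 <= t <= s -> h t <= h s.
  move=> /andP[t0 ts].
  apply: (@ger0_derive1_ndecr _ h 0 m) => //.
  - by move=> y; rewrite in_itv /= derive1E (@derive_val _ _ _ _ _ _ _ (dh y)) => /Hge0.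
  - exact: fc dh _ _.
have xle t : 0 <= t <= s -> `|x t| <= e.
  move=> ts; rewrite -(ler_pXn2r (n := 2)) ?nnegrE // -normrX ger0_norm ?sqr_ge0 //.
  have := di t; have := hle t ts; have := sqr_ge0 (h t); nra.
have [n] := EVT_max s0 (fc _ _ dx 0 s); rewrite in_itv /= => /andP[n0 ns] maxn.
have crit t : 0 < t < s -> X t = 0 -> x n <= x t.
  move=> /andP[t0 ts] Xt; have Ht : 0 <= H t by apply: Hge0; rewrite t0 (lt_le_trans ts sm).
  have := un t; rewrite Xt expr0n add0r => /eqP; rewrite sqrf_eq1 => /orP[]/eqP H1.
    by have := su t n; rewrite Xt H1; lra.
  by move: Ht; rewrite H1; lra.
have XH t : 0 <= H t -> 1 <= `|X t| + H t.
  move=> H0; have := un t; have := normr_ge0 (X t); rewrite -(real_normK (num_real (X t))); nra.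
(* [n] splits the arc in two parts, of lengths at most x n + h n and
   (h s - h n) + (x n - x s). *)
have up t : 0 < t < n -> 1 <= X t + H t.
  move=> /andP[t0 tn].
  have X0 : 0 <= X t.
    apply: (@derive_ge0_unimodal _ x X 0 n dx) => [y /andP[y0 yn]|y /andP[y0 yn]|].
    + by apply: maxn; rewrite in_itv /= y0 (le_trans yn ns).
    + by apply: crit; rewrite y0 (lt_le_trans yn ns).
    + by rewrite t0.
  by have := XH t; rewrite (ger0_norm X0); apply; apply: Hge0; lra.
have down t : n < t < s -> 1 <= H t - X t.
  move=> /andP[nt ts].
  (* A decreasing x becomes increasing when the arc is travelled backwards. *)
  have dx' (y : R) : is_derive y 1 (fun z : R => x (- z)) (- X (- y)).
    have dN : is_derive y 1 (fun z : R => - z) (- 1 : R) by exact: is_deriveN.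
    by have := @is_derive1_comp R x (fun z => - z) y _ _ (dx (- y)) dN; rewrite mulrN1.
  have X0 : 0 <= - X (- - t).
    apply: (@derive_ge0_unimodal _ _ _ (- s) (- n) dx').
    + by move=> y yy; rewrite opprK; apply: maxn; rewrite in_itv /=; lra.
    + by move=> y yy Xy; rewrite opprK; apply: crit; lra.
    + by lra.
  rewrite opprK oppr_ge0 in X0.
  by have := XH t; rewrite (ler0_norm X0) addrC; apply; apply: Hge0; lra.
have l1 := increment_ge_length (fun t => is_deriveD (dx t) (dh t)) up n0.
have l2 := increment_ge_length (fun t => is_deriveB (dh t) (dx t)) down ns.
have xn : x n <= e by apply: le_trans (ler_norm _) (xle _ _); rewrite n0.
have xs : - e <= x s by have := xle s; rewrite ler_norml s0 lexx => /(_ isT) /andP[].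
move: l1 l2; rewrite !fctE x0 h0; lra.
Qed.

(** * The scalar product of the plane *)

Lemma dotpC {R : realType} (u v : R * R) : dotp u v = dotp v u.
Proof. by rewrite /dotp; ring. Qed.

Lemma dotpBl {R : realType} (u v w : R * R) : dotp (u - v) w = dotp u w - dotp v w.
Proof. by rewrite /dotp /=; ring. Qed.

Lemma dotpZl {R : realType} (a : R) (u w : R * R) : dotp (a *: u) w = a * dotp u w.
Proof. by rewrite /dotp /= -[_ *: _]/(a * _) -[_ *: u.2]/(a * u.2); ring. Qed.

Lemma dotp_self_le0 {R : realType} (u : R * R) : dotp u u <= 0 -> u = 0.
Proof.
rewrite /dotp -!expr2 => u0.
have [] : u.1 ^+ 2 = 0 /\ u.2 ^+ 2 = 0.
  by have := sqr_ge0 u.1; have := sqr_ge0 u.2; lra.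
move=> /eqP; rewrite sqrf_eq0 => /eqP u1 /eqP; rewrite sqrf_eq0 => /eqP u2.
by rewrite (surjective_pairing u) u1 u2.
Qed.

Lemma dotp_cvg {R : realType} {T : Type} {F : set_system T} {FF : Filter F}
    {g : T -> R * R} {v : R * R} (u : R * R) :
  g @ F --> v -> dotp (g z) u @[z --> F] --> dotp v u.
Proof.
move=> gv; rewrite /dotp.
have g1 : (g z).1 @[z --> F] --> v.1 by apply: cvg_comp gv _; exact: cvg_fst.
have g2 : (g z).2 @[z --> F] --> v.2 by apply: cvg_comp gv _; exact: cvg_snd.
by apply: cvgD; apply: cvgM => //; exact: cvg_cst.
Qed.

Lemma is_derive_dotp {R : realType} {g : R -> R * R} {v : R * R} {s : R} (p u : R * R) :
  is_derive s 1 g v -> is_derive s 1 (fun t => dotp (g t - p) u) (dotp v u).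
Proof.
case=> dg <-.
have lim_dg : dotp (h^-1 *: (g (h *: 1 + s) - g s)) u @[h --> (0:R)^'] --> dotp ('D_1 g s) u.
  exact: dotp_cvg.
have E : (fun h : R => dotp (h^-1 *: (g (h *: 1 + s) - g s)) u) =
  (fun h : R => h^-1 * (dotp (g (h *: 1 + s) - p) u - dotp (g s - p) u)).
  by apply/funext => h; rewrite dotpZl !dotpBl; ring.
rewrite E in lim_dg.
split; first by apply/cvg_ex; eexists; exact: lim_dg.
exact: cvg_lim lim_dg.
Qed.

Lemma rot90_dotp {R : realType} (u v : R * R) : dotp (rot90 u) (rot90 v) = dotp u v.
Proof. by rewrite /dotp /rot90 /=; ring. Qed.

Lemma dotp_frame {R : realType} (u n : R * R) : dotp n n = 1 ->
  dotp u (rot90 n) ^+ 2 + dotp u n ^+ 2 = dotp u u.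
Proof.
move=> nn; rewrite -[RHS]mulr1 -nn /dotp /rot90 /=; ring.
Qed.

Lemma dotp_norm_le {R : realType} (u n : R * R) : dotp n n = 1 -> `|dotp u n| <= 2 * `|u|.
Proof.
rewrite /dotp -!expr2 => nn.
have le1 (z : R) : z ^+ 2 <= 1 -> `|z| <= 1.
  by move=> z1; rewrite -(ler_pXn2r (n := 2)) ?nnegrE // expr1n -normrX ger0_norm ?sqr_ge0.
have n1 : `|n.1| <= 1 by apply: le1; have := sqr_ge0 n.2; lra.
have n2 : `|n.2| <= 1 by apply: le1; have := sqr_ge0 n.1; lra.
have [u1 u2] : `|u.1| <= `|u| /\ `|u.2| <= `|u|.
  by rewrite prod_normE !le_max !lexx orbT.
rewrite (le_trans (ler_normD _ _)) // !normrM mulr2n mulrDl mul1r.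
by apply: lerD; rewrite -[leRHS]mulr1; apply: ler_pM.
Qed.

(** * Normals and curvature of convex bodies *)

(** Along the line x + t v, the height over the tangent is t <v, n>, while the
    graph stays o(t) away from the tangent: for small t > 0 the sign of <v, n>
    decides on which side of the graph the point is. *)
Lemma boundary_graph_ray {R : realType} {S : set (R * R)} {x n : R * R} {f : R -> R} {v : R * R} :
  Cdiff 1 f -> boundary_graph S x n f ->
  \forall t \near (0 : R)^'+,
    (0 < dotp v n -> S (x + t *: v)) /\ (dotp v n < 0 -> ~ S (x + t *: v)).
Proof.
move=> [df _] [_ f0 f'0 nS].
have dfx : is_derive (0:R) 1 f 0.
  by split; [exact: (df 0%N)|rewrite -derive1E].
set b := dotp v (rot90 n); set a := dotp v n.
have cv : x + t *: v @[t --> (0:R)^'+] --> x.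
  rewrite -[X in _ --> X](addr0 x) -(scale0r v).
  apply: cvg_at_right_filter; apply: cvgD; first exact: cvg_cst.
  by apply: cvgZ; [exact: cvg_id|exact: cvg_cst].
have ct : t * b @[t --> (0:R)^'+] --> (0 : R).
  rewrite -[X in _ --> X](mul0r b).
  by apply: cvg_at_right_filter; apply: cvgM; [exact: cvg_id|exact: cvg_cst].
have [a0|a0] := eqVneq a 0.
  by apply: nearW => t; rewrite a0 ltxx.
have e0 : 0 < `|a| / (`|b| + 1) by rewrite divr_gt0 ?normr_gt0 // ltr_wpDl.
have qE : `|a| / (`|b| + 1) * (`|b| + 1) = `|a|.
  by rewrite divfK // gt_eqF // ltr_wpDl.
move: (nbhs_right_gt (0:R)) (ct _ (derive_approx dfx e0)) (cv _ nS).
apply: filterS3 => t t0 /=; rewrite add0r f0 subr0 mul0r subr0.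
rewrite (addrC x) addrK !dotpZl -/a -/b normrM (gtr0_norm t0).
move: qE e0; set q := _ / _ => qE q0 fb [SP SN].
have {}fb : `|f (t * b)| < t * `|a| by rewrite -qE; nra.
move: fb; rewrite ltr_norml => /andP[fb1 fb2].
split=> s0; [apply: SP; rewrite gtr0_norm // in fb2|apply: SN].
by rewrite ltr0_norm // mulrN opprK in fb1.
Qed.

(** The property that selects [inward_normal]. *)
Definition c1_normal {R : realType} (S : set (R * R)) (x n : R * R) :=
  exists f, Cdiff 1 f /\ boundary_graph S x n f.

(** Otherwise the direction n - m would be pointing into S according to n and
    out of S according to m. *)
Lemma c1_normal_unique {R : realType} {S : set (R * R)} {x n m : R * R} :
  c1_normal S x n -> c1_normal S x m -> n = m.
Proof.
move=> [f [df gf]] [g [dg gg]].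
have [nn mm] : dotp n n = 1 /\ dotp m m = 1 by case: gf; case: gg.
have dd : dotp (n - m) (n - m) = 2 * (1 - dotp m n).
  by move: nn mm; rewrite /dotp /=; lra.
have [d0|d0] : 0 < dotp (n - m) (n - m) \/ dotp (n - m) (n - m) <= 0.
  by case: ltP; [left|right].
- have : \forall t \near (0:R)^'+, False.
    move: (boundary_graph_ray (v := n - m) df gf) (boundary_graph_ray (v := n - m) dg gg).
    apply: filterS2 => t [+ _] [_ +].
    rewrite !dotpBl nn mm (dotpC n m) => H1 H2.
    by apply: H2; [|apply: H1]; move: d0; rewrite dd; lra.
  by move=> /filter_ex [].
- by apply/eqP; rewrite -subr_eq0; apply/eqP; exact: dotp_self_le0.
Qed.

Lemma Cdiff_le {R : realType} {m k : nat} {f : R -> R} :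
  (k <= m)%N -> Cdiff m f -> Cdiff k f.
Proof.
move=> km [df cf]; split=> [j jk|]; first exact: df (leq_trans jk km).
move: km; rewrite leq_eqVlt => /predU1P[->//|km] t.
by apply: differentiable_continuous; apply/derivable1_diffP; exact: df.
Qed.

Lemma inward_normal_c1 {R : realType} {S : set (R * R)} {m : nat} {x : R * R} :
  regular_boundary (Cdiff m.+1) S -> boundary S x -> c1_normal S x (inward_normal S x).
Proof.
move=> rS /rS [n [f [df gf]]]; apply: (@getI _ [set n | c1_normal S x n] n).
by exists f; split=> //; exact: Cdiff_le df.
Qed.

(** The graph that regularity provides is over the tangent of some normal
    vector; [curvature] refers to [inward_normal], and uniqueness identifies
    the two. *)
Lemma curvature_graph {R : realType} {S : set (R * R)} {x : R * R} {m : nat} :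
  regular_boundary (Cdiff m.+2) S -> boundary S x ->
  exists f, [/\ Cdiff 2 f, boundary_graph S x (inward_normal S x) f &
    curvature S x = f^`(2) 0].
Proof.
move=> rS bx; have [n [f [df gf]]] := rS x bx.
have E : inward_normal S x = n.
  apply: c1_normal_unique (inward_normal_c1 rS bx) _.
  by exists f; split=> //; exact: Cdiff_le df.
rewrite -E in gf.
have [g [? ?] gE] := getI (P := [set f^`(2) 0 | f in
       [set f | Cdiff 2 f /\ boundary_graph S x (inward_normal S x) f]])
  (ex_intro2 _ _ f (conj (Cdiff_le (isT : 2 <= m.+2)%N df) gf) erefl).
by exists g; split=> //; rewrite gE.
Qed.

Lemma convex_set_segment {R : realType} {S : set (R * R)} {x y : R * R} {t : R} :
  convex_set S -> S x -> S y -> 0 <= t <= 1 -> S (x + t *: (y - x)).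
Proof.
move=> cS Sx Sy /andP[t0 t1].
have := cS y x (Itv01 t0 t1); rewrite !inE => /(_ Sy Sx).
rewrite /conv /=.
congr (S _); apply: (@addIr _ (t *: x)).
by rewrite scalerBr -[RHS]addrA subrK -addrA -scalerDl (addrC (unstable.onem t))
  unstable.add_onemK scale1r addrC.
Qed.

(** The segment from x to y stays in S, so it cannot leave x on the outer side
    of the tangent line. *)
Lemma convex_support {R : realType} {S : set (R * R)} {x n y : R * R} :
  convex_set S -> S x -> S y -> c1_normal S x n -> 0 <= dotp (y - x) n.
Proof.
move=> cS Sx Sy [f [df gf]]; rewrite leNgt; apply/negP => yn.
have : \forall t \near (0:R)^'+, False.
  move: (nbhs_right_gt (0:R)) (nbhs_right_lt (ltr01 : (0:R) < 1))
    (boundary_graph_ray (v := y - x) df gf).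
  apply: filterS3 => t t0 t1 [_ /(_ yn)]; apply.
  by apply: convex_set_segment => //; rewrite !ltW.
by move=> /filter_ex [].
Qed.

(** The derivative f' is k t + o(t) at 0, so t f'(t) >= (k / 2) t^2 near 0, and
    the mean value theorem can be applied to f - (k / 4) t^2. *)
Lemma quadratic_minorant {R : realType} {f : R -> R} {k : R} :
  Cdiff 2 f -> f 0 = 0 -> f^`() 0 = 0 -> f^`(2) 0 = k -> 0 < k ->
  \forall t \near (0:R), k / 4 * t ^+ 2 <= f t.
Proof.
move=> [df _] f0 f'0 f''0 k0.
have d1 (t : R) : is_derive t 1 f (f^`() t).
  by split; [exact: (df 0%N)|rewrite derive1E].
have d2 : is_derive (0:R) 1 f^`() k.
  by split; [exact: (df 1%N)|rewrite -derive1E -f''0].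
have k2 : 0 < k / 2 by rewrite divr_gt0.
have [d /= d0 dP] := (nbhs_ballP _ _).1 (derive_approx d2 k2).
have f'P u : `|u| < d -> k / 2 * u ^+ 2 <= u * derive1 f u.
  move=> ud; have := dP u; rewrite -ball_normE /ball_ /= sub0r normrN => /(_ ud).
  rewrite add0r f'0 subr0; have [u0|u0] := leP 0 u.
    by rewrite (ger0_norm u0) ler_norml => /andP[+ _]; nra.
  by rewrite (ltr0_norm u0) ler_norml => /andP[_]; nra.
apply/nbhs_ballP; exists d => //= t; rewrite -ball_normE /ball_ /= sub0r normrN => td.
have dg (u : R) : is_derive u 1 (fun z : R => f z - k / 4 * z ^+ 2) (derive1 f u - k / 2 * u).
  have dq : is_derive u 1 (fun z : R => k / 4 * z ^+ 2) (k / 2 * u).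
    apply: is_derive_eq.
    by rewrite -![_ *: _]/(_ * _) mulr1; field.
  exact: is_deriveB (d1 u) dq.
have gc u v : {within `[u, v], continuous (fun z : R => f z - k / 4 * z ^+ 2)}.
  by apply: derivable_within_continuous => y _; exact: (@ex_derive _ _ _ _ _ _ _ (dg y)).
have g'P u : `|u| < d -> 0 <= u * (derive1 f u - k / 2 * u).
  by move=> /f'P; lra.
case: (ltgtP t 0) => [t0|t0|->]; last by rewrite f0 expr0n mulr0.
- have [u] := MVT t0 (fun z _ => dg z) (gc _ _); rewrite in_itv /= => /andP[tu u0].
  have /g'P : `|u| < d by rewrite ltr0_norm //; move: td; rewrite ltr0_norm //; lra.
  by rewrite f0 expr0n mulr0; nra.
- have [u] := MVT t0 (fun z _ => dg z) (gc _ _); rewrite in_itv /= => /andP[u0 ut].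
  have /g'P : `|u| < d by rewrite gtr0_norm //; move: td; rewrite gtr0_norm //; lra.
  by rewrite f0 expr0n mulr0; nra.
Qed.

(** Near x the curvature puts S inside a parabola tangent at x.  The homothety
    of centre x and ratio l maps the convex set S into itself, and for l small it
    maps the bounded set S into this neighbourhood of x: the parabola for the
    image is a wider parabola for the whole of S.  In bounded sets parabolas and
    discs give the same estimate. *)
Lemma compact_convex_disc {R : realType} {S : set (R * R)} {x : R * R} {m : nat} :
  compact S -> convex_set S -> regular_boundary (Cdiff m.+2) S -> S x ->
  boundary S x -> 0 < curvature S x ->
  exists2 a : R, 0 <= a & forall y, S y ->
    dotp (y - x) (y - x) <= a * dotp (y - x) (inward_normal S x).
Proof.
move=> kS cS rS Sx bx; have [f [df gf ->]] := curvature_graph rS bx => k0.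
have [d d0 dP] := (nbhs_ballP _ _).1
  (let: And4 _ f0 f'0 _ := gf in quadratic_minorant (k := derive1n 2 f 0) df f0 f'0 erefl k0).
rewrite /= in d0.
case: gf => nn f0 f'0 /nbhs_ballP [d' /= d'0 d'P].
set n := inward_normal S x in nn d'P *; set k := f^`(2) 0 in k0 dP.
have [M [_ MP]] := compact_bounded kS.
pose N := `|M| + 1 + `|x|.
have N0 : 0 < N by rewrite ltr_wpDr // ltr_wpDl.
have NP y : S y -> `|y - x| <= N.
  move=> Sy; rewrite (le_trans (ler_normB _ _)) // lerD2r.
  have : M < `|M| + 1 by rewrite ltr_pwDr // ler_norm.
  by move=> /MP /(_ y Sy).
(* |v| <= N bounds the coordinates of v in the frame (rot90 n, n) by 2 N; the
   factor 4 makes the bounds l |v| < d' and l |<v, rot90 n>| < d strict. *)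
pose l := Num.min 1 (Num.min d d' / (4 * N)).
have m0 : 0 < Num.min d d' by rewrite lt_min d0.
have l0 : 0 < l by rewrite lt_min ltr01 divr_gt0 // mulr_gt0.
have l1 : l <= 1 by rewrite ge_min lexx.
have l2 : l * (4 * N) <= Num.min d d' by rewrite -ler_pdivlMr ?mulr_gt0 // ge_min lexx orbT.
have [ld ld'] : l * (4 * N) <= d /\ l * (4 * N) <= d'.
  by apply/andP; rewrite -le_min.
exists (4 / (k * l) + 2 * N).
  by rewrite addr_ge0 // ?mulr_ge0 ?invr_ge0 // ?ltW // mulr_gt0.
move=> y Sy; set v := y - x; rewrite -(dotp_frame v n nn).
have vN : `|v| <= N by exact: NP.
have hN := dotp_norm_le v n nn.
have tN : `|dotp v (rot90 n)| <= 2 * `|v| by apply: dotp_norm_le; rewrite rot90_dotp.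
have Sl : S (l *: v + x) by rewrite addrC; apply: convex_set_segment => //; rewrite ltW.
have := d'P (x + l *: v); rewrite /= -ball_normE /ball_ /= opprD addrA subrr sub0r.
rewrite normrN normrZ (gtr0_norm l0).
rewrite (addrC x) addrK !dotpZl => below.
have ltd' : l * `|v| < d' by nra.
(* The point x + l v is in S, so it is not below the graph of f. *)
have fle : f (l * dotp v (rot90 n)) <= l * dotp v n.
  rewrite leNgt; apply/negP => hf; exact: ((below ltd').2 hf Sl).
have := dP (l * dotp v (rot90 n)); rewrite /= -ball_normE /ball_ /= sub0r normrN normrM.
rewrite (gtr0_norm l0).
have ltd : l * `|dotp v (rot90 n)| < d by nra.
move=> /(_ ltd) /le_trans /(_ fle).
have kl0 : 0 < k * l by rewrite mulr_gt0.
move: hN; set h := dotp v n; set t := dotp v (rot90 n) => hN.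
rewrite exprMn => q.
have {q} q : t ^+ 2 <= 4 / (k * l) * h.
  rewrite mulrAC ler_pdivlMr // -(ler_pM2l l0); move: q; rewrite -/k; lra.
have h0 : 0 <= h.
  rewrite -(pmulr_rge0 _ (_ : 0 < 4 / (k * l))); last by rewrite divr_gt0.
  exact: le_trans (sqr_ge0 t) q.
by rewrite mulrDl; apply: lerD => //; move: hN; rewrite ger0_norm //; nra.
Qed.

(** * Arc length along the boundary of a convex body *)

Lemma boundary_sub {R : realType} {S : set (R * R)} : closed S -> boundary S `<=` S.
Proof. by move=> cS y [/cS]. Qed.

(** The tangent to the curve at gamma t is the inward normal turned clockwise by
    a right angle, and [loop_support] is [convex_support] written in the frame
    at p.  The height is positive away from p because the disc meets its tangent
    at p only, and the curve is simple. *)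
Lemma boundary_convex_loop {R : realType} {S : set (R * R)} {p : R * R} {m : nat} {L a : R}
    {gamma : R -> R * R} :
  closed S -> convex_set S -> regular_boundary (Cdiff m.+1) S ->
  arclength_param S L gamma -> gamma 0 = p ->
  (forall y, S y -> dotp (y - p) (y - p) <= a * dotp (y - p) (inward_normal S p)) ->
  convex_loop (fun t => dotp (gamma t - p) (- rot90 (inward_normal S p)))
              (fun t => dotp (gamma t - p) (inward_normal S p))
              (fun t => dotp (inward_normal S (gamma t)) (inward_normal S p))
              (fun t => - dotp (rot90 (inward_normal S (gamma t))) (inward_normal S p))
              L a.
Proof.
move=> clS cS rS [L0 dg rg ig] g0 disc.
have bg t : boundary S (gamma t) by rewrite -rg; exists t.
have Sg t : S (gamma t) by exact: boundary_sub.
have ng t : c1_normal S (gamma t) (inward_normal S (gamma t)).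
  exact: inward_normal_c1 rS (bg t).
have ug t : dotp (inward_normal S (gamma t)) (inward_normal S (gamma t)) = 1.
  by case: (ng t) => f [_ []].
have up : dotp (inward_normal S p) (inward_normal S p) = 1 by rewrite -g0.
set n := inward_normal S p in up disc *.
have gL : gamma L = p by rewrite -g0; apply/ig; exists (-1); rewrite mulN1r subrr.
have hge0 t : 0 <= dotp (gamma t - p) n.
  have := convex_support cS (Sg 0) (Sg t) (ng 0); by rewrite g0.
split.
- move=> s; have := is_derive_dotp p (- rot90 n) (dg s).
  congr is_derive; rewrite /outward_normal /dotp /rot90 /=; ring.
- move=> s; have := is_derive_dotp p n (dg s).
  congr is_derive; rewrite /outward_normal /dotp /rot90 /=; ring.
- move=> s; rewrite sqrrN -(ug s) -(dotp_frame _ _ up) addrC; congr (_ + _).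
  rewrite /dotp /rot90 /=; ring.
- move=> s t; have := convex_support cS (Sg s) (Sg t) (ng s).
  congr (0 <= _); rewrite -[LHS]mulr1 -up /dotp /rot90 /=; ring.
- by rewrite g0 subrr /dotp /= !mul0r addr0.
- by rewrite gL subrr /dotp /= !mul0r addr0.
- move=> s; apply: le_trans (disc _ (Sg s)).
  rewrite -(dotp_frame (gamma s - p) n up) lerD2r.
  by rewrite le_eqVlt; apply/orP; left; apply/eqP; rewrite /dotp /=; ring.
- move=> s /andP[s0 sL]; rewrite lt_neqAle hge0 andbT; apply/negP => /eqP hs.
  have := disc _ (Sg s); rewrite -hs mulr0 => /dotp_self_le0 /eqP.
  rewrite subr_eq0 -g0 => /eqP E.
  have [z] := (ig 0 s).1 (esym E); rewrite add0r => zE.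
  move: s0 sL; rewrite zE pmulr_lgt0 // ltr0z => z0.
  rewrite -[ltRHS]mul1r ltr_pM2r // ltrz1; move: z0.
  by rewrite gtz0_ge1 leNgt => /negP.
Qed.

(** The coordinate s lies in ]-L/2, L/2], so |s| is the length of the shorter
    arc from p to c, and it suffices to bound one of the two arcs; the position
    of c with respect to the highest point tells which one. *)
Lemma geodesic_coordinate_le {R : realType} {S : set (R * R)} {p c : R * R} {m : nat} {s a e : R} :
  closed S -> convex_set S -> regular_boundary (Cdiff m.+1) S ->
  (forall y, S y -> dotp (y - p) (y - p) <= a * dotp (y - p) (inward_normal S p)) ->
  geodesic_coordinate S p c s ->
  0 <= a -> 0 <= e ->
  a * dotp (c - p) (inward_normal S p) <= e ^+ 2 -> dotp (c - p) (inward_normal S p) <= e ->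
  `|s| <= 4 * e.
Proof.
move=> clS cS rS disc [L [gamma [ga g0 gs /andP[sL1 sL2]]]] a0 e0 he2 he.
have lo := boundary_convex_loop clS cS rS ga g0 disc.
case: ga => L0 dg _ ig.
set h := fun t => dotp (gamma t - p) (inward_normal S p) in lo.
have hc : {within `[0, L], continuous h}.
  apply: derivable_within_continuous => y _.
  exact: (@ex_derive _ _ _ _ _ _ _ (is_derive_dotp p _ (dg y))).
have [M] := EVT_max (ltW L0) hc; rewrite in_itv /= => /andP[M0 ML] maxM.
have hM t : 0 <= t <= L -> h t <= h M by move=> tL; apply: maxM; rewrite in_itv.
have [s' /andP[s'0 s'L] [gs' ss']] : exists2 s', 0 <= s' <= L &
    gamma s' = c /\ `|s| = Num.min s' (L - s').
  have [s0|s0] := leP 0 s.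
    exists s; first by lra.
    by split=> //; rewrite ger0_norm // min_l //; lra.
  exists (s + L); first by lra.
  split; last by rewrite ltr0_norm // min_r; lra.
  by rewrite -gs; apply/esym/ig; exists 1; rewrite mul1r.
have hs' : h s' = dotp (c - p) (inward_normal S p) by rewrite /h gs'.
rewrite -hs' in he he2; rewrite ss'.
have [s'M|Ms'] := leP s' M.
  rewrite ge_min; apply/orP; left.
  by apply: loop_arc_le lo ML hM _ e0 he2 a0 he; rewrite s'0.
rewrite ge_min; apply/orP; right.
have LL t : L - (L - t) = t by rewrite opprB addrC subrK.
apply: (loop_arc_le (convex_loop_reflect lo) (m := L - M)) => //=; rewrite ?LL //.
- by lra.
- by move=> t tL; apply: hM; lra.
- by lra.
Qed.

(** * Doubly exponential convergence *)

(** The smallness of u K suffices at any rank K, because a shift of the index by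
    one amounts to replacing rho by its square root. *)
Lemma quadratic_recursion_doubly_exponential {R : realType} {A : R} {K : nat} {u : nat -> R} :
  0 < A -> (forall k, 0 <= u k) -> (forall k, u k.+1 <= A * u k ^+ 2) -> A * u K < 1 ->
  exists B rho : R, [/\ 0 < B, 0 < rho, rho < 1 & forall k, u k <= B * rho ^+ (2 ^ k)].
Proof.
move=> A0; elim: K u => [|K IH] u u0 uS uK.
  (* 1/2 only serves to have rho > 0 when u 0 = 0. *)
  exists A^-1, (Num.max (A * u 0%N) 2^-1); split.
  - by rewrite invr_gt0.
  - by rewrite lt_max invr_gt0 ltr0n orbT.
  - by rewrite gt_max uK invf_lt1 // ltr1n.
  elim=> [|k IHk].
    by rewrite expn0 expr1 ler_pdivlMl // le_max lexx.
  apply: le_trans (uS k) _; rewrite expnSr exprM.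
  set q := _ ^+ (2 ^ k) in IHk *.
  have -> : A^-1 * q ^+ 2 = A * (A^-1 * q) ^+ 2 by field; rewrite gt_eqF.
  by rewrite ler_pM2l // ler_pXn2r // nnegrE // (le_trans (u0 k)).
have [B [rho [B0 r0 r1 HB]]] := IH (fun k => u k.+1) (fun k => u0 k.+1) (fun k => uS k.+1) uK.
have sr0 : 0 < Num.sqrt rho by rewrite sqrtr_gt0.
have Bu : B <= B + u 0%N / Num.sqrt rho by rewrite lerDl divr_ge0 // ltW.
exists (B + u 0%N / Num.sqrt rho), (Num.sqrt rho); split => //.
- exact: lt_le_trans Bu.
- by rewrite -sqrtr1 ltr_sqrt.
case=> [|k].
  by rewrite expn0 expr1 mulrDl divfK ?gt_eqF // lerDr mulr_ge0 // ltW.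
rewrite expnS exprM sqr_sqrtr ?(ltW r0) //.
by apply: le_trans (HB k) _; rewrite ler_wpM2r // exprn_ge0 // ltW.
Qed.

Theorem theorem10p1 (R : realType) (C Omega : nat -> set (R * R))
    (Omega_oo : set (R * R)) (p : R * R) (A r : R)
    (c : nat -> R * R) (s : nat -> R)
    (Hconf : nested_tangent_configuration C Omega Omega_oo)
    (Hp : forall k, tangency_set (C k) (C k.+1) p)
    (HB : uniform_bounds C Omega p)
    (A_gt0 : 0 < A) (r_gt0 : 0 < r)
    (Hneighborhood : forall (c' : nat -> R * R) (s' : nat -> R),
        transition_orbit C Omega c' ->
        (forall k, geodesic_coordinate (C k) p (c' k) (s' k)) ->
        `|s' 0%N| < r ->
        [/\ forall k, `|s' k| < r,
            c' @ \oo --> p &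
            forall k, `|s' k.+1| <= A * `|s' k| ^+ 2])
    (Horbit : transition_orbit C Omega c)
    (Hs : forall k, geodesic_coordinate (C k) p (c k) (s k))
    (Hs0 : `|s 0%N| < r) :
  exists K rho : R, [/\ 0 < K, 0 < rho, rho < 1 &
    forall k : nat, `|s k| <= K * rho ^+ (2 ^ k)].
Proof.
have [_ cp quad] := Hneighborhood _ _ Horbit Hs Hs0.
have clC k : closed (C k).
  by apply: compact_closed; [exact: norm_hausdorff|exact: ntc_C_compact Hconf k].
have [bp0 _ _] := Hp 0%N.
have Cp : C 0%N p := boundary_sub (clC 0%N) _ bp0.
have [a a0 disc] := compact_convex_disc (@ntc_C_compact _ _ _ _ Hconf 0%N)
  (@ntc_C_convex _ _ _ _ Hconf 0%N) (@ntc_C_C3 _ _ _ _ Hconf 0%N) Cp bp0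
  (ntc_C_curvature Hconf bp0).
set n := inward_normal (C 0%N) p in disc.
have nk k : inward_normal (C k) p = n.
  elim: k => // k <-; have [_ _] := Hp k.
  by rewrite /outward_normal => /oppr_inj.
have Csub k : C k `<=` C 0%N.
  by elim: k => // k IH y /(ntc_C_decr Hconf) /IH.
(* With this e, [geodesic_coordinate_le] gives A |s K| <= 4 A e = 1/2. *)
pose e := (8 * A)^-1.
have e0 : 0 < e by rewrite invr_gt0 mulr_gt0.
have hlim : dotp (c k - p) n @[k --> \oo] --> (0 : R).
  have -> : 0 = dotp (p - p) n by rewrite dotpBl subrr.
  by apply: dotp_cvg; apply: cvgB cp _; exact: cvg_cst.
have ahlim : a * dotp (c k - p) n @[k --> \oo] --> (0 : R).
  by rewrite -(mulr0 a); apply: cvgM => //; exact: cvg_cst.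
have e20 : 0 < e ^+ 2 by rewrite exprn_gt0.
have [K [heK ahK]] : exists K, dotp (c K - p) n <= e /\ a * dotp (c K - p) n <= e ^+ 2.
  have : \forall k \near \oo, dotp (c k - p) n <= e /\ a * dotp (c k - p) n <= e ^+ 2.
    by apply: filterI; [exact: cvgr_le hlim _ e0|exact: cvgr_le ahlim _ e20].
  by move=> /filter_ex.
have sK : `|s K| <= 4 * e.
  apply: (geodesic_coordinate_le (clC K) (@ntc_C_convex _ _ _ _ Hconf K) (@ntc_C_C3 _ _ _ _ Hconf K)
    _ (Hs K) a0 (ltW e0)); rewrite nk // => y /Csub; exact: disc.
apply: (quadratic_recursion_doubly_exponential A_gt0 (K := K)) => //.
have : A * (4 * e) = 2^-1 by rewrite /e; field; rewrite gt_eqF.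
have : A * `|s K| <= A * (4 * e) by rewrite ler_pM2l.
lra.
Qed.
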